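(* Let $k\ge 2$ be an integer, $n=3k-1$, and let $x_0,x_1,\dots,x_{n-1}$ be the eigenvalues of the adjacency matrix of the Andrásfai graph $\mathrm{And}(k)$, indexed by $x_l=\sum_{j=0}^{k-1}\omega^{(3j+1)l}$ with $\omega=e^{2\pi i/n}$. Then $x_{k-1}=x_{2k}$, and this is the second largest eigenvalue of the adjacency matrix, i.e. if $\lambda_0\ge\lambda_1\ge\dots\ge\lambda_{n-1}$ are the eigenvalues listed with multiplicity in non-increasing order, then $x_{k-1}=x_{2k}=\lambda_1$.
   Context: For an integer $k\ge 1$ put $n=3k-1$. The Andrásfai graph $\mathrm{And}(k)$ is the Cayley graph $\mathrm{Cay}(\mathbb{Z}_n,S)$ of the additive group $\mathbb{Z}_n=\{0,1,\dots,n-1\}$ with connection set $S=\{x\in\mathbb{Z}_n : x\equiv 1 \bmod 3\}=\{1,4,7,\dots,3k-2\}$, where the congruence mod $3$ is for the representatives $0,1,\dots,n-1$. That is, the vertices are the elements of $\mathbb{Z}_n$, and $u,v$ are adjacent iff $v-u\in S$ (the set $S$ satisfies $S=-S$ and $0\notin S$). The adjacency matrix is circulant, and its eigenvalues, listed with multiplicity, are the real numbers $x_l=\sum_{j=0}^{k-1}\omega^{(3j+1)l}$, $0\le l\le n-1$, where $\omega=e^{2\pi i/n}$; they are not necessarily listed in decreasing order. *)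

(* Defs.v *)
From HB Require Import structures.
From mathcomp Require Import all_boot all_order all_algebra.
From mathcomp Require Import all_reals trigo.
From mathcomp Require Import complex.

Set Implicit Arguments.
Unset Strict Implicit.
Unset Printing Implicit Defensive.

Import Order.TTheory GRing.Theory Num.Theory.

Local Open Scope ring_scope.

Definition cayley (G : finZmodType) (S : {set G}) : rel G :=
  fun u v => v - u \in S.

Definition andrasfai_order (k : nat) : nat := (3 * k - 1)%N.

(* ['Z_n] is the ring of integers mod n only for n > 1, that is, for k >= 1.
   The congruence mod 3 is that of the representatives 0, ..., n - 1. *)
Definition andrasfai_set (k : nat) : {set 'Z_(andrasfai_order k)} :=
  [set x : 'Z_(andrasfai_order k) | (x == 1 %[mod 3])%N].

Definition andrasfai (k : nat) : rel 'Z_(andrasfai_order k) :=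
  cayley (andrasfai_set k).

Arguments andrasfai k : clear implicits.

Definition adjacency_mx (R : pzSemiRingType) (m : nat) (e : rel 'I_m) : 'M[R]_m :=
  \matrix_(i, j) (e i j)%:R.

(* Here [s] has length [m] because [char_poly A] has degree [m]. *)
Definition eigenvalue_list (R : realType) (m : nat) (A : 'M[R]_m)
    (s : seq R) : Prop :=
  sorted >=%R s /\ char_poly A = \prod_(z <- s) ('X - z%:P).

(* e^(2 pi i / n) *)
Definition omega (R : realType) (n : nat) : R[i] :=
  (cos (2 * pi / n%:R) +i* sin (2 * pi / n%:R))%C.

Definition andrasfai_eigenvalue (R : realType) (k l : nat) : R[i] :=
  \sum_(j < k) omega R (andrasfai_order k) ^+ ((3 * j + 1) * l).

(* Main.v *)
Require Import Defs.
From mathcomp Require Import all_boot all_order all_algebra.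
From mathcomp Require Import all_reals trigo.
From mathcomp Require Import complex.
From mathcomp Require Import zify ring lra.

Set Implicit Arguments.
Unset Strict Implicit.
Unset Printing Implicit Defensive.

Import Order.TTheory GRing.Theory Num.Theory.

Local Open Scope ring_scope.

(** Write [z = omega ^+ l].  The eigenvalue [x_l] is a geometric sum of ratio
    [z ^+ 3], so [x_l * (z ^+ 3 - 1) = z * (z ^+ (3 * k) - 1)].  As
    [3 * k = n + 1] and [z ^+ n = 1], the right-hand side is [z * (z - 1)];
    when [z != 1] one factor [z - 1] cancels, and dividing by [z] gives

      x_l = 1 / (1 + z + z^-1) = 1 / (1 + 2 cos (2 pi l / n)),  0 < l < n.

    This closed form ([andrasfai_eigenvalueE]) reduces the theorem to a
    comparison of cosines.  By the symmetry [l <-> n - l] take [2 l <= n], where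
    the cosine decreases with [l].  It equals - 1/2 at angle 2 pi / 3, so [x_l] is
    positive exactly when [3 l < n], that is [l <= k - 1], and then it
    increases with [l]; for the other [l] it is negative.  Hence among the
    [x_l] with [l != 0] the maximum is attained at [l = k - 1] and at its mirror
    image [n - (k - 1) = 2 k] ([andrasfai_eigenvalue_bound]).

    At most one eigenvalue, [x_0], can exceed this value, and at least two
    eigenvalues reach it.  These two counts already force it into second
    position of the sorted list ([second_of_sorted]).  That the [x_l] are all
    the eigenvalues, with multiplicity, is the diagonalization of circulant
    matrices by the Vandermonde matrix of the powers of a primitive root of
    unity ([char_poly_circulant]). *)

(** * Spectrum of a circulant matrix *)

Lemma char_poly_similar (F : fieldType) (n : nat) (P A B : 'M[F]_n) :
  P \in unitmx -> A *m P = P *m B -> char_poly A = char_poly B.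
Proof.
move=> Pu eqAB.
have detP0 : \det (map_mx polyC P) != 0 :> {poly F}.
  by rewrite det_map_mx polyC_eq0 -unitfE -unitmxE.
apply: (mulIf detP0); rewrite [RHS]mulrC -!det_mulmx; congr (\det _).
rewrite mulmxBl mulmxBr -!map_mxM eqAB; congr (_ - _).
by rewrite scalar_mxC.
Qed.

Lemma Vandermonde_prim_unit (F : fieldType) (n : nat) (w : F) :
  n.-primitive_root w ->
  Vandermonde n (\row_(j < n) w ^+ j) \in unitmx.
Proof.
move=> w_prim; rewrite unitmxE det_Vandermonde unitfE.
apply/prodf_neq0 => i _; apply/prodf_neq0 => j lt_ij.
rewrite !mxE subr_eq0 (eq_prim_root_expr w_prim) !modn_small ?ltn_ord //.
by rewrite gtn_eqF.
Qed.

(** Column [l] of the Vandermonde matrix of the powers of [w] is the character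
    [x |-> w ^+ (x * l)] of the cyclic group, and a matrix that commutes with
    the translations of the group acts on each character as a scalar. *)
Lemma char_poly_circulant (F : fieldType) (m : nat) (w : F) (f : 'I_m.+1 -> F) :
  m.+1.-primitive_root w ->
  char_poly (\matrix_(i, j) f (j - i)) =
    \prod_(l < m.+1) ('X - (\sum_(x < m.+1) f x * w ^+ (x * l))%:P).
Proof.
move=> w_prim.
pose d := \row_(l < m.+1) \sum_(x < m.+1) f x * w ^+ (x * l).
rewrite (char_poly_similar (B := diag_mx d) (Vandermonde_prim_unit w_prim)).
  rewrite char_poly_trig ?diag_mx_is_trig //.
  by apply: eq_bigr => l _; rewrite !mxE eqxx mulr1n.
apply/matrixP => i l; rewrite mul_mx_diag !mxE.
rewrite (reindex_inj (addIr i)) mulr_sumr; apply: eq_bigr => x _ /=.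
rewrite !mxE addrK mulrCA; congr (_ * _).
have wl1 : (w ^+ l) ^+ m.+1 = 1 by rewrite exprAC (prim_expr_order w_prim) expr1n.
by rewrite /= (expr_mod _ wl1) addnC exprD [(x * l)%N]mulnC exprM.
Qed.

(** * The second entry of a sorted list *)

(** The values above [e a] occur at most once, at [o], so the second entry is
    at most [e a]; the values reaching [e a] occur at least twice, at [a] and
    [b], so it is at least [e a]. *)
Lemma second_of_sorted (R : realDomainType) (I : finType) (e : I -> R)
    (o a b : I) (s : seq R) :
  sorted >=%R s -> perm_eq s [seq e i | i : I] ->
  a != b -> e a = e b -> (forall i, i != o -> e i <= e a) -> s`_1 = e a.
Proof.
move=> s_sorted /permP s_e neq_ab eq_ab le_a.
have countE p : count p s = #|[pred i | p (e i)]|.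
  by rewrite s_e /image_mem count_map cardE -size_filter enumT.
have gt_a : (count (> e a) s <= 1)%N.
  rewrite countE -(card1 o); apply: subset_leq_card; apply/subsetP => i /=.
  by rewrite !inE; apply: contraTT => /le_a; rewrite -leNgt.
have ge_a : (1 < count (>= e a) s)%N.
  rewrite countE; apply: leq_trans (_ : #|[set a; b]| <= _)%N.
    by rewrite cards2 neq_ab.
  apply: subset_leq_card; apply/subsetP => i.
  by rewrite !inE => /pred2P[] ->; rewrite -?eq_ab.
case: s s_sorted gt_a ge_a {s_e countE} => [|x [|y s]] //=.
  by case: (_ <= x).
case/andP=> le_yx; rewrite (path_sortedE (rev_trans le_trans)).
case/andP=> /allP le_sy _ gt_a ge_a.
apply/le_anti/andP; split; rewrite leNgt; apply/negP => lt_y.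
  by move: gt_a; rewrite lt_y (lt_le_trans lt_y le_yx).
suff s0 : count (>= e a) s = 0%N.
  by move: ge_a; rewrite s0 [_ <= y]leNgt lt_y; case: (_ <= x).
apply/eqP; rewrite -leqn0 leqNgt -has_count; apply/hasPn => z /le_sy le_zy.
by rewrite -ltNge (le_lt_trans le_zy).
Qed.

(** * Roots of unity and their angles *)

(** With [c] this cosine, the triple angle formula and [cos (2 * pi) = 1] give
    [4 c^3 - 3 c - 1 = (c - 1) (2 c + 1)^2 = 0]. *)
Lemma cos_2pi3 (R : realType) : cos (2 * pi / 3) = - 2^-1 :> R.
Proof.
set c := cos _.
have [pi_gt0 c_lt1] : 0 < pi :> R /\ c < 1.
  have pi_gt0 := pi_gt0 R; split=> //.
  by rewrite /c -[ltRHS]cos0 ltr_cos ?in_itv /=; lra.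
have: cos (2 * pi / 3 *+ 2 + 2 * pi / 3) = 1 :> R.
  by rewrite -[RHS]cos2pi; congr cos; field.
rewrite cosD cos_mulr2n sin_mulr2n -/c => cos3.
have /eqP : (c - 1) * (2 * c + 1) ^+ 2 = 0.
  have s2 := cos2Dsin2 (2 * pi / 3 : R); rewrite -/c in s2.
  have := congr1 (fun t => 2 * c * t) s2; lra.
rewrite mulf_eq0 subr_eq0 (lt_eqF c_lt1) /= sqrf_eq0 => /eqP; lra.
Qed.

Definition root_angle (R : realType) (n l : nat) : R := 2 * pi * l%:R / n%:R.

Lemma omegaX (R : realType) (n l : nat) :
  omega R n ^+ l =
    (cos (root_angle R n l) +i* sin (root_angle R n l))%C.
Proof.
elim: l => [|l IHl]; first by rewrite expr0 /root_angle mulr0 mul0r cos0 sin0.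
have -> : root_angle R n l.+1 = 2 * pi / n%:R + root_angle R n l.
  by rewrite /root_angle -natr1; ring.
by rewrite exprS IHl cosD sinD; apply/eqP; rewrite eq_complex /= eqxx addrC eqxx.
Qed.

Lemma cos_root_angle_sym (R : realType) (n l : nat) :
  (0 < n)%N -> (l <= n)%N ->
  cos (root_angle R n (n - l)) = cos (root_angle R n l).
Proof.
move=> n_gt0 le_ln; rewrite -[RHS]cosN -[RHS]cosD2pi; congr cos.
rewrite /root_angle natrB //; field.
by rewrite pnatr_eq0 -lt0n.
Qed.

Lemma cos_root_angle_lt (R : realType) (n l1 l2 : nat) :
  (l1 < l2)%N -> (2 * l2 <= n)%N ->
  cos (root_angle R n l2) < cos (root_angle R n l1).
Proof.
move=> lt_l le_l2n; have pi_gt0 := pi_gt0 R.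
have n_gt0 : 0 < n%:R :> R by rewrite ltr0n; lia.
have lt_angle : root_angle R n l1 < root_angle R n l2.
  by rewrite ltr_pM2r ?invr_gt0 // ltr_pM2l ?ltr_nat //; lra.
have angle_ge0 l : 0 <= root_angle R n l by rewrite !mulr_ge0 ?invr_ge0 ?ler0n ?ltW.
have angle_le_pi : root_angle R n l2 <= pi.
  have -> : root_angle R n l2 = pi * ((2 * l2)%:R / n%:R).
    by rewrite /root_angle natrM; ring.
  by rewrite ger_pMr // ler_pdivrMr // mul1r ler_nat.
by rewrite ltr_cos ?in_itv //= !angle_ge0 ?(le_trans (ltW lt_angle)).
Qed.

Lemma cos_root_angle_third (R : realType) (n l : nat) :
  (0 < n)%N -> (2 * l <= n)%N ->
  (- 2^-1 < cos (root_angle R n l)) = (3 * l < n)%N.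
Proof.
move=> n_gt0 le_l2n; have pi_gt0 := pi_gt0 R.
rewrite -cos_2pi3 ltr_cos ?in_itv /=; last 2 first.
- have -> : root_angle R n l = pi * ((2 * l)%:R / n%:R).
    by rewrite /root_angle natrM; ring.
  rewrite ger_pMr // ler_pdivrMr ?ltr0n // mul1r ler_nat le_l2n andbT.
  by rewrite !mulr_ge0 ?invr_ge0 ?ler0n ?ltW.
- by apply/andP; split; lra.
have -> : root_angle R n l = 2 * pi / 3 * ((3 * l)%:R / n%:R).
  by rewrite /root_angle natrM; field; rewrite pnatr_eq0 -lt0n.
by rewrite gtr_pMr ?ltr_pdivrMr ?ltr0n ?mul1r ?ltr_nat //; lra.
Qed.

Lemma cos_root_angle_lt1 (R : realType) (n l : nat) :
  (0 < l < n)%N -> cos (root_angle R n l) < 1.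
Proof.
wlog le_l2n : l / (2 * l <= n)%N => [IH|] /andP[l_gt0 lt_ln].
  have [le|gt] := leqP (2 * l) n; first by apply: IH; rewrite ?l_gt0.
  by rewrite -cos_root_angle_sym ?IH; lia.
rewrite -[ltRHS]cos0 -(_ : root_angle R n 0 = 0).
  exact: cos_root_angle_lt.
by rewrite /root_angle mulr0 mul0r.
Qed.

Lemma omega_prim (R : realType) (n : nat) :
  (0 < n)%N -> n.-primitive_root (omega R n).
Proof.
move=> n_gt0; have n_neq0 : n%:R != 0 :> R by rewrite pnatr_eq0 -lt0n.
apply/andP; split=> //; apply/forallP => i; apply/eqP.
rewrite unity_rootE omegaX /root_angle.
have [-> | lt_in] := eqVneq i.+1 n.
  have -> : 2 * pi * n%:R / n%:R = pi *+ 2 :> R by field.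
  by rewrite cos2pi sin2pi eqxx.
by rewrite eq_complex /= lt_eqF // cos_root_angle_lt1 //= ltn_neqAle lt_in ltn_ord.
Qed.

(** * The eigenvalues of the Andrasfai graph *)

(** The sum telescopes against [z ^+ 3 - 1].  Cancelling [z - 1], and not the
    whole of [z ^+ 3 - 1], leads to [x_l * (1 + z + z^-1) = 1], and this
    equation itself shows that [1 + 2 cos] does not vanish. *)
Lemma andrasfai_eigenvalueE (R : realType) (k l : nat) :
  (0 < k)%N -> ~~ (andrasfai_order k %| l)%N ->
  andrasfai_eigenvalue R k l =
    ((1 + 2 * cos (root_angle R (andrasfai_order k) l))^-1)%:C%C.
Proof.
move=> k_gt0.
have n_gt0 : (0 < andrasfai_order k)%N by rewrite /andrasfai_order; lia.
have w_prim := omega_prim R n_gt0.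
rewrite (prim_order_dvd w_prim).
set z := omega R _ ^+ l => z_neq1.
have z_n : z ^+ andrasfai_order k = 1.
  by rewrite exprAC (prim_expr_order w_prim) expr1n.
set E := andrasfai_eigenvalue R k l.
have EE : E = \sum_(j < k) z * (z ^+ 3) ^+ j.
  by apply: eq_bigr => j _; rewrite mulnC exprM -/z exprD exprM expr1 mulrC.
have telescope : E * (z ^+ 3 - 1) = z * (z - 1).
  rewrite EE -mulr_sumr -mulrA; congr (z * _).
  rewrite mulrC -subrX1 -exprM.
  rewrite (_ : (3 * k)%N = (andrasfai_order k).+1) ?exprS ?z_n ?mulr1 //.
  by rewrite /andrasfai_order; lia.
have EM : E * (z ^+ 2 + z + 1) = z.
  by apply: (mulIf (_ : z - 1 != 0)); rewrite ?subr_eq0 //; rewrite -telescope; ring.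
have z_cos : z ^+ 2 + z + 1 =
    z * (1 + 2 * cos (root_angle R (andrasfai_order k) l))%:C%C.
  rewrite /z omegaX; set t := root_angle R _ _; apply/eqP.
  rewrite eq_complex /=; have := cos2Dsin2 t.
  by move=> cs; apply/andP; split; apply/eqP; nra.
have z_neq0 : z != 0.
  apply/eqP => z0; move/eqP: z_n.
  by rewrite z0 expr0n gtn_eqF // eq_sym oner_eq0.
have E1 : E * (1 + 2 * cos (root_angle R (andrasfai_order k) l))%:C%C = 1.
  by apply: (mulfI z_neq0); rewrite mulr1 mulrCA -z_cos.
rewrite fmorphV; set a := real_complex R _ in E1 *.
have a_neq0 : a != 0.
  by apply: contra_eq_neq E1 => ->; rewrite mulr0 eq_sym oner_neq0.
by apply: (mulIf a_neq0); rewrite E1 mulVf.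
Qed.

Lemma sum_mod3 (V : nmodType) (k : nat) (F : nat -> V) : (0 < k)%N ->
  \sum_(0 <= x < 3 * k - 1 | (x == 1 %[mod 3])%N) F x = \sum_(j < k) F (3 * j + 1)%N.
Proof.
case: k => // k _; rewrite -(big_mkord xpredT (fun j => F (3 * j + 1)%N)).
elim: k => [|k IHk].
  by rewrite big_nat1 big_mkcond !big_nat_recr //= big_geq // !add0r.
(* The range grows by 3 k + 2, 3 k + 3 and 3 k + 4; the last is 1 mod 3. *)
rewrite (_ : (3 * k.+2 - 1)%N = (3 * k.+1 - 1).+3); last lia.
rewrite big_mkcond 3?big_nat_recr //= -big_mkcond IHk [RHS]big_nat_recr //=.
rewrite ifF; last lia.
rewrite ifF; last lia.
rewrite ifT; last lia.
by rewrite !addr0; congr (_ + F _); lia.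
Qed.

Lemma andrasfai_char_poly (R : realType) (k : nat) : (0 < k)%N ->
  map_poly (real_complex R) (char_poly (adjacency_mx R (andrasfai k))) =
    \prod_(l < andrasfai_order k) ('X - (andrasfai_eigenvalue R k l)%:P).
Proof.
move=> k_gt0.
have n_gt1 : (1 < andrasfai_order k)%N by rewrite /andrasfai_order; lia.
have w_prim := omega_prim R (ltnW n_gt1).
rewrite map_char_poly.
pose f (x : 'Z_(andrasfai_order k)) : R[i] := ((x == 1 %[mod 3])%N)%:R.
have -> : map_mx (real_complex R) (adjacency_mx R (andrasfai k)) =
    \matrix_(i, j) f (j - i).
  by apply/matrixP => i j; rewrite !mxE rmorph_nat /andrasfai /cayley inE.
(* ['Z_n] consists of ordinals below [(Zp_trunc n).+2], which is [n] only up
   to a rewriting. *)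
rewrite -[X in X.-primitive_root _](Zp_cast n_gt1) in w_prim.
rewrite (char_poly_circulant f w_prim) [in RHS](esym (Zp_cast n_gt1)).
apply: eq_bigr => l _; congr ('X - _%:P).
rewrite /andrasfai_eigenvalue -(sum_mod3 (fun x => omega R _ ^+ (x * l)) k_gt0).
rewrite -/(andrasfai_order k) -[X in index_iota _ X](Zp_cast n_gt1) big_mkord.
by rewrite [RHS]big_mkcond; apply: eq_bigr => x _; rewrite /f mulr_natl;
  case: ifP.
Qed.

(** Replacing [l] by [n - l] reduces to [2 l <= n], where there are two cases.
    If [l <= k - 1], both denominators are positive and the cosine is
    decreasing.  If [l >= k], then the angle is at least 2 pi / 3 and the
    left-hand side is not positive. *)
Lemma andrasfai_eigenvalue_bound (R : realType) (k l : nat) :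
  (2 <= k)%N -> (0 < l < andrasfai_order k)%N ->
  (1 + 2 * cos (root_angle R (andrasfai_order k) l))^-1
    <= (1 + 2 * cos (root_angle R (andrasfai_order k) (k - 1)))^-1.
Proof.
rewrite /andrasfai_order => hk; set n := (3 * k - 1)%N.
have n_gt0 : (0 < n)%N by lia.
wlog le_l2n : l / (2 * l <= n)%N => [IH|] /andP[l_gt0 lt_ln].
  have [le|gt] := leqP (2 * l) n; first by apply: IH; rewrite ?l_gt0.
  by rewrite -cos_root_angle_sym ?(ltnW lt_ln) // IH; lia.
have top_gt0 : 0 < 1 + 2 * cos (root_angle R n (k - 1)).
  suff : - 2^-1 < cos (root_angle R n (k - 1)) by lra.
  by rewrite cos_root_angle_third //; lia.
have [le_lk | lt_kl] := leqP l (k - 1).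
  have le_cos : cos (root_angle R n (k - 1)) <= cos (root_angle R n l).
    move: le_lk; rewrite leq_eqVlt => /predU1P[-> // | lt_lk].
    by apply/ltW/cos_root_angle_lt => //; lia.
  by rewrite lef_pV2 ?posrE //; lra.
apply: (@le_trans _ _ 0); last by rewrite invr_ge0 ltW.
suff : cos (root_angle R n l) <= - 2^-1 by rewrite invr_le0; lra.
by rewrite leNgt cos_root_angle_third // -leqNgt; lia.
Qed.

Theorem theorem3p3 (R : realType) (k : nat) (hk : (2 <= k)%N) :
  andrasfai_eigenvalue R k (k - 1) = andrasfai_eigenvalue R k (2 * k) /\
  forall lam : seq R,
    eigenvalue_list (adjacency_mx R (andrasfai k)) lam ->
    andrasfai_eigenvalue R k (2 * k) = (lam`_1)%:C%C.
Proof.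
set n := andrasfai_order k.
have n_def : n = (3 * k - 1)%N by [].
have k_gt0 : (0 < k)%N by lia.
have E_real l : (0 < l < n)%N -> andrasfai_eigenvalue R k l =
    ((1 + 2 * cos (root_angle R n l))^-1)%:C%C.
  by case/andP=> l_gt0 lt_ln; rewrite andrasfai_eigenvalueE // gtnNdvd.
have lt_k1 : (k - 1 < n)%N by lia.
have lt_2k : (2 * k < n)%N by lia.
have eq_E : andrasfai_eigenvalue R k (k - 1) = andrasfai_eigenvalue R k (2 * k).
  rewrite !E_real; [| lia..]; rewrite -[in RHS]cos_root_angle_sym; [| lia..].
  by rewrite (_ : (n - 2 * k)%N = (k - 1)%N) //; lia.
split=> // lam [lam_sorted lam_char].
have perm_E : perm_eq [seq z%:C%C | z <- lam]
                      [seq andrasfai_eigenvalue R k l | l : 'I_n].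
  apply: prod_XsubC_eq; rewrite !big_map -(andrasfai_char_poly R k_gt0) lam_char.
  by rewrite rmorph_prod; apply: eq_bigr => z _; rewrite rmorphB /= map_polyX map_polyC.
pose e (l : 'I_n) := complex.Re (andrasfai_eigenvalue R k l).
have perm_e : perm_eq lam [seq e l | l : 'I_n].
  have := perm_map (@complex.Re R) perm_E.
  by rewrite /image_mem -!map_comp map_id.
have lt_0 : (0 < n)%N by lia.
rewrite -eq_E (second_of_sorted (o := Ordinal lt_0) (a := Ordinal lt_k1)
  (b := Ordinal lt_2k) lam_sorted perm_e).
- by rewrite /e /= E_real //; lia.
- by rewrite -val_eqE /=; lia.
- by rewrite /e /= eq_E.
move=> l; rewrite -val_eqE /= -lt0n => l_gt0.
rewrite /e /= !E_real ?l_gt0 //=; last lia.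
by apply: andrasfai_eigenvalue_bound; rewrite ?l_gt0 /=.
Qed.
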